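(* Let $\theta>0$ and $n\ge1$. Under the Ewens-like distribution for records with parameter $\theta$ on $\mathfrak{S}_n$, for every $i\in[n]$, the probability that $\sigma$ has a record at position $i$ equals $\dfrac{\theta}{\theta+i-1}$.
   Context: $\mathfrak{S}_n$ is the set of permutations of $[n]=\{1,\dots,n\}$. A permutation $\sigma$ has a record at position $i$ if $\sigma(i)>\sigma(j)$ for all $j\in[i-1]$; $\mathrm{rec}(\sigma)$ denotes the number of records. The Ewens-like distribution for records with parameter $\theta>0$ on $\mathfrak{S}_n$ gives each $\sigma$ probability $\theta^{\mathrm{rec}(\sigma)}/\sum_{\rho\in\mathfrak{S}_n}\theta^{\mathrm{rec}(\rho)}$ (the normalizing constant equals $\theta(\theta+1)\cdots(\theta+n-1)$). *)

(* Defs.v *)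
From HB Require Import structures.
From mathcomp Require Import all_boot all_order all_algebra all_fingroup.
From mathcomp Require Import reals.
Set Implicit Arguments.
Unset Strict Implicit.
Unset Printing Implicit Defensive.

Import Order.TTheory GRing.Theory Num.Theory.
Local Open Scope ring_scope.

(* ['I_n] stands for [n] = {1, ..., n} with everything shifted down by one:
   [i : 'I_n] is the position (or value) [i.+1].  The shift preserves the
   order, so records are unaffected. *)
Definition is_record (n : nat) (s : 'S_n) (i : 'I_n) : bool :=
  [forall j : 'I_n, (j < i)%N ==> (s j < s i)%N].

Definition rec (n : nat) (s : 'S_n) : nat := #|[set i | is_record s i]|.

Definition ewens_rec (R : realType) (theta : R) (n : nat) (s : 'S_n) : R :=
  theta ^+ rec s / \sum_(r : 'S_n) theta ^+ rec r.

Definition Pr (R : realType) (T : finType) (p : T -> R) (A : {set T}) : R :=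
  \sum_(x in A) p x.

Lemma ewens_rec_ge0 (R : realType) (theta : R) (n : nat) (s : 'S_n) :
  0 < theta -> 0 <= ewens_rec theta s.
Proof.
move=> t0; apply: divr_ge0; first by rewrite exprn_ge0 // ltW.
by apply: sumr_ge0 => r _; rewrite exprn_ge0 // ltW.
Qed.

Lemma ewens_rec_sum1 (R : realType) (theta : R) (n : nat) :
  0 < theta -> Pr (ewens_rec theta (n := n)) [set: 'S_n] = 1.
Proof.
move=> t0; rewrite /Pr (eq_bigl xpredT) => [|s]; last by rewrite inE.
rewrite -mulr_suml divff // gt_eqF // (bigD1 1%g) //=.
rewrite ltr_pwDl ?exprn_gt0 //.
by apply: sumr_ge0 => r _; rewrite exprn_ge0 // ltW.
Qed.

(* Main.v *)
(* Deleting the last entry of a permutation of [n+1] and standardizing the rest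
   is a bijection onto [n+1] x S_n that leaves the records at the first n
   positions unchanged, and the last position is a record exactly when the
   deleted value is n+1.  The total weight is therefore multiplied by
   theta + n at each step, and so is the weight of a record at any of the
   first n positions, while a record at position n+1 has weight theta times
   the total weight on S_n. *)
Require Import Defs.
From HB Require Import structures.
From mathcomp Require Import all_boot all_order all_algebra all_fingroup.
From mathcomp Require Import reals.
Import Order.TTheory GRing.Theory Num.Theory.
Local Open Scope ring_scope.

(** Every other position precedes the last one, so a record there must beat the maximal value
    wherever that value sits. *)
Lemma is_record_ord_max (n : nat) (s : 'S_n.+1) :
  is_record s ord_max = (s ord_max == ord_max).
Proof.
apply/forallP/eqP => [rec_max|s_max j]; last first.
  apply/implyP=> lt_j_max; rewrite s_max ltn_neqAle -ltnS ltn_ord andbT.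
  apply: contraTneq lt_j_max => sj_max.
  suff -> : j = ord_max by rewrite ltnn.
  by apply: (@perm_inj _ s); rewrite s_max; apply: val_inj.
(* The record condition is tested at the position carrying the value [ord_max], which nothing
   exceeds. *)
apply: contraTeq (rec_max (s^-1%g ord_max)) => s_max; rewrite permKV.
rewrite [X in X ==> _]ltn_neqAle -ltnS ltn_ord andbT.
rewrite [X in _ ==> X]ltnNge -ltnS ltn_ord implybF negbK.
rewrite (_ : (_ == _) = (s^-1%g ord_max == ord_max)) //.
by rewrite (canF_eq (permKV s)) eq_sym.
Qed.

(** Inserting the last value [k] only bumps the values of [t] that are at least [k], which preserves
    their order; the new position precedes no other. *)
Lemma is_record_lift_perm (n : nat) (k : 'I_n.+1) (t : 'S_n) (i : 'I_n) :
  is_record (lift_perm ord_max k t) (lift ord_max i) = is_record t i.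
Proof.
apply/forallP/forallP => rec_i j; last first.
  case: (unliftP ord_max j) => [j' ->|->]; last first.
    by rewrite lift_max ltnNge ltnW.
  rewrite !lift_perm_lift !lift_max.
  by have := rec_i j'; rewrite !ltnNge /= leq_bump2.
have := rec_i (lift ord_max j).
by rewrite !lift_perm_lift !lift_max !ltnNge /= leq_bump2.
Qed.

Lemma rec_lift_perm (n : nat) (k : 'I_n.+1) (t : 'S_n) :
  rec (lift_perm ord_max k t) = (rec t + (k == ord_max))%N.
Proof.
rewrite /rec -!sum1_card [LHS]big_mkcond big_ord_recr /=.
congr (_ + _)%N; last by rewrite inE is_record_ord_max lift_perm_id; case: eqP.
rewrite [RHS]big_mkcond; apply: eq_bigr => i _; rewrite !inE.
rewrite (_ : widen_ord _ i = lift ord_max i) ?is_record_lift_perm //.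
by apply: val_inj; exact/esym/lift_max.
Qed.

(** Injectivity suffices, since both sides have [(n+1)!] elements. *)
Lemma lift_perm_bij (n : nat) (i0 : 'I_n.+1) :
  bijective (fun kt : 'I_n.+1 * 'S_n => lift_perm i0 kt.1 kt.2).
Proof.
apply: inj_card_bij => [[k t] [k' t'] /= eq_lift|]; last first.
  by rewrite card_prod card_ord !card_Sn factS.
have eq_k : k = k' by rewrite -(lift_perm_id i0 k t) eq_lift lift_perm_id.
rewrite {}eq_k in eq_lift *; congr (_, _); apply/permP => i.
by apply: (@lift_inj _ k'); rewrite -!(lift_perm_lift i0) eq_lift.
Qed.

Lemma big_lift_perm (R : Type) (idx : R) (op : Monoid.com_law idx) (n : nat)
    (i0 : 'I_n.+1) (F : 'S_n.+1 -> R) :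
  \big[op/idx]_(s : 'S_n.+1) F s
  = \big[op/idx]_(k : 'I_n.+1) \big[op/idx]_(t : 'S_n) F (lift_perm i0 k t).
Proof.
rewrite pair_bigA (reindex (fun kt => lift_perm i0 kt.1 kt.2)) //=.
exact/onW_bij/lift_perm_bij.
Qed.

Lemma sum_ord_max (R : nzRingType) (theta : R) (n : nat) :
  \sum_(k < n.+1) theta ^+ (k == ord_max) = theta + n%:R.
Proof.
rewrite (bigD1 ord_max) //= eqxx expr1; congr (_ + _).
rewrite (eq_bigr (fun=> 1)) => [|k /negPf ->//].
by rewrite sumr_const cardC1 card_ord.
Qed.

Lemma sum_rec_weight (R : comNzRingType) (theta : R) (n : nat) :
  \sum_(s : 'S_n.+1) theta ^+ rec s
  = (theta + n%:R) * \sum_(t : 'S_n) theta ^+ rec t.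
Proof.
rewrite (big_lift_perm _ _ _ _ ord_max) -sum_ord_max mulr_suml.
apply: eq_bigr => k _; rewrite mulr_sumr; apply: eq_bigr => t _.
by rewrite rec_lift_perm exprD mulrC.
Qed.

(** The probability formula with denominators cleared, so that the induction on [n] uses ring
    identities only. *)
Lemma sum_record_weight (R : comNzRingType) (theta : R) (n : nat) (i : 'I_n) :
  (theta + i%:R) * \sum_(s : 'S_n | is_record s i) theta ^+ rec s
  = theta * \sum_(s : 'S_n) theta ^+ rec s.
Proof.
elim: n i => [[]//|n IHn] i; rewrite sum_rec_weight big_mkcond.
rewrite (big_lift_perm _ _ _ _ ord_max).
case: (unliftP ord_max i) => [j ->|->].
  (* The induction hypothesis brings out [theta + j] on the right; what remains is that the record
     weight at [j] gains the factor [theta + n]. *)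
  rewrite [RHS]mulrCA -(IHn j) [RHS]mulrCA lift_max; congr (_ * _).
  rewrite -sum_ord_max mulr_suml.
  apply: eq_bigr => k _; rewrite mulr_sumr [RHS]big_mkcond /=.
  apply: eq_bigr => t _; rewrite is_record_lift_perm rec_lift_perm.
  by rewrite exprD mulrC.
(* Here [i] has value [n], so the factor [theta + n] cancels; only [k = ord_max] then
   contributes. *)
rewrite [RHS]mulrCA; congr (_ * _).
rewrite (bigD1 ord_max) //= [X in _ + X]big1 ?addr0 => [|k /negPf k_max].
  rewrite mulr_sumr; apply: eq_bigr => t _.
  by rewrite is_record_ord_max lift_perm_id eqxx rec_lift_perm eqxx exprD mulrC.
by apply: big1 => t _; rewrite is_record_ord_max lift_perm_id k_max.
Qed.

Theorem theorem1 (R : realType) (theta : R) (n : nat)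
    (theta_gt0 : 0 < theta) (n_gt0 : (1 <= n)%N) (i : 'I_n) :
  Pr (fun s : 'S_n => ewens_rec theta s) [set s : 'S_n | is_record s i]
  = theta / (theta + i.+1%:R - 1).
Proof.
have i_neq0 : theta + i%:R != 0 by rewrite gt_eqF // ltr_pwDl.
have total_neq0 : \sum_(s : 'S_n) theta ^+ rec s != 0.
  rewrite gt_eqF // (bigD1 1%g) //= ltr_pwDl ?exprn_gt0 //.
  by apply: sumr_ge0 => s _; rewrite exprn_ge0 // ltW.
rewrite /Pr -mulr_suml (eq_bigl (is_record (n := n) ^~ i)) => [|s]; last first.
  by rewrite inE.
(* The one-based position [i.+1] minus 1 is the ordinal [i] itself. *)
rewrite -natr1 addrA addrK; apply/eqP.
by rewrite eqr_div // mulrC sum_record_weight.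
Qed.
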